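(* There exists a faithful function $f\in\mathcal F$ such that, for every real number $x$, the continued $f$-expansion $E_f(x)$ is periodic (i.e. lies in $\mathcal C_i$ and is eventually periodic) if and only if $x$ is a cubic irrational number (an algebraic number of degree exactly $3$ over $\mathbb Q$).
   Context: For real $x$, $\lfloor x\rfloor$ is the greatest integer $\le x$ and $\{x\}=x-\lfloor x\rfloor$. Let $\mathcal C_i$ be the set of formal infinite integer sequences $[a_0;a_1,a_2,\dots]$ with $a_j\ge1$ for all $j\ge1$, and $\mathcal C_t$ the set of formal finite integer sequences $[a_0;a_1,\dots,a_n]$ ($n\ge0$) with $a_j\ge1$ for $1\le j\le n$ and $a_n\ge2$ if $n\ge1$; put $\mathcal C=\mathcal C_i\cup\mathcal C_t$. Let $\mathcal F$ be the set of strictly decreasing continuous functions $f:(1,\infty)\to(0,1)$ with $\lim_{x\to1^+}f(x)=1$ and $\lim_{x\to+\infty}f(x)=0$, and for $f\in\mathcal F$ let $\phi=f^{-1}:(0,1)\to(1,\infty)$. The expansion function $E_f:\mathbb R\to\mathcal C$: given $x_0\in\mathbb R$, set $a_0=\lfloor x_0\rfloor$; if $x_k$ is not an integer, set $x_{k+1}=\phi(\{x_k\})$ and $a_{k+1}=\lfloor x_{k+1}\rfloor$. If some $x_n$ is an integer (the first such), $E_f(x_0)=[a_0;a_1,\dots,a_n]\in\mathcal C_t$; otherwise $E_f(x_0)=[a_0;a_1,a_2,\dots]\in\mathcal C_i$. The evaluation function $V_f$: on $\mathcal C_t$, $V_f([a_0])=a_0$ and $V_f([a_0;a_1,\dots,a_n])=a_0+f(V_f([a_1;a_2,\dots,a_n]))$;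 on $\mathcal C_i$, $V_f([a_0;a_1,a_2,\dots])=\lim_{n\to\infty}V_f([a_0;a_1,\dots,a_n])$ whenever the limit exists. A function $f\in\mathcal F$ is faithful if $V_f$ is defined on all of $\mathcal C$ and $E_f:\mathbb R\to\mathcal C$ is a bijection with inverse $V_f$. ''Periodic'' is used in the same sense as in the classical statement that the usual continued fraction expansion of $x$ is periodic iff $x$ is a quadratic irrational, i.e. eventually periodic. *)

(* Defs.v *)
From HB Require Import structures.
From mathcomp Require Import all_boot all_order all_algebra.
From mathcomp Require Import all_classical all_reals all_analysis.
Import Order.TTheory GRing.Theory Num.Theory.
Import numFieldNormedType.Exports.

Set Implicit Arguments.
Unset Strict Implicit.
Unset Printing Implicit Defensive.

Local Open Scope classical_set_scope.
Local Open Scope ring_scope.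

(* [Fin a0 [:: a1; ...; an]] is [a0; a1, ..., an], and [Inf a] is
   [a 0; a 1, a 2, ...]. *)
Inductive expansion : Type :=
| Fin of int & seq int
| Inf of (nat -> int).

Definition C_t : set expansion := [set c | match c with
  | Fin a0 s => all (fun a : int => 1 <= a) s /\ (s <> [::] -> 2 <= last a0 s)
  | Inf _ => False
  end].

Definition C_i : set expansion := [set c | match c with
  | Fin _ _ => False
  | Inf a => forall j : nat, (1 <= j)%N -> 1 <= a j
  end].

Definition C_all : set expansion := C_i `|` C_t.

Definition expansion_periodic (c : expansion) : Prop :=
  match c with
  | Fin _ _ => False
  | Inf a => exists N p : nat,
      (0 < p)%N /\ forall n : nat, (N <= n)%N -> a (n + p)%N = a n
  end.

Section FExpansion.
Variable R : realType.
Implicit Types (f : R -> R) (x : R).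

(* A function (1, oo) -> (0, 1) is represented by an f : R -> R of which only
   the restriction to `]1, +oo[ is ever used. *)
Definition in_classF f : Prop :=
  [/\ set_fun `]1, +oo[ `]0, 1[ f,
      {in `]1, +oo[ &, forall x y, x < y -> f y < f x},
      {within `]1, +oo[, continuous f},
      f x @[x --> 1^'+] --> (1 : R) &
      f x @[x --> +oo] --> (0 : R)].

Definition phi f : R -> R := 'pinv_(fun=> 0) `]1, +oo[ f.

Definition fract x : R := x - (Num.floor x)%:~R.

(* The iterates x_0, x_1, ...; those after the first integer are junk and are
   never used by [fexp]. *)
Definition fexp_orbit f x (k : nat) : R := iter k (fun y => phi f (fract y)) x.

Definition fexp_digit f x (k : nat) : int := Num.floor (fexp_orbit f x k).

Definition fexp f x : expansion :=
  match pselect (exists n, fexp_orbit f x n \is a Num.int) with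
  | left h =>
      Fin (fexp_digit f x 0)
        [seq fexp_digit f x k | k <- iota 1 (ex_minn h)]
  | right _ => Inf (fexp_digit f x)
  end.

(* The truncation [a0; a1, ..., an] of an infinite sequence with an = 1 is not
   in C_t and its evaluation calls for f(1): we extend f by continuity,
   f(1) = 1. *)
Definition ext1 f x : R := if x == 1 then 1 else f x.

Fixpoint feval_fin f (a0 : int) (s : seq int) : R :=
  match s with
  | [::] => a0%:~R
  | a1 :: s' => a0%:~R + ext1 f (feval_fin f a1 s')
  end.

Definition convergent f (a : nat -> int) (n : nat) : R :=
  feval_fin f (a 0%N) [seq a k | k <- iota 1 n].

(* Meaningful on Inf a only when [convergent f a] converges. *)
Definition feval f (c : expansion) : R :=
  match c with
  | Fin a0 s => feval_fin f a0 s
  | Inf a => limn (convergent f a)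
  end.

Definition feval_defined f (c : expansion) : Prop :=
  match c with
  | Fin _ _ => True
  | Inf a => cvgn (convergent f a)
  end.

Definition faithful_fun f : Prop :=
  [/\ (forall c, C_all c -> feval_defined f c),
      set_bij [set: R] C_all (fexp f),
      (forall x, feval f (fexp f x) = x) &
      (forall c, C_all c -> fexp f (feval f c) = c)].

Definition algebraic_of_degree (d : nat) x : Prop :=
  exists p : {poly rat},
    [/\ p \is monic, irreducible_poly p, root (map_poly ratr p) x &
        size p = d.+1].

Definition cubic_irrational x : Prop := algebraic_of_degree 3 x.

End FExpansion.

(* Main.v *)
Require Import Defs.
From mathcomp Require Import all_boot all_order all_algebra.
From mathcomp Require Import all_classical all_reals all_analysis.
From mathcomp Require Import ring lra zify.
Import Order.TTheory GRing.Theory Num.Theory.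
Import numFieldNormedType.Exports.

Set Implicit Arguments.
Unset Strict Implicit.
Unset Printing Implicit Defensive.

Local Open Scope classical_set_scope.
Local Open Scope ring_scope.

(** The classical choice [x |-> 1 / x] is faithful, because prepending two
    digits contracts distances by a factor 4.  If [h] is an increasing bijection
    of the line fixing 0 and commuting with [x |-> x + 1], then
    [f := h o (1 / .) o h^-1] is faithful too, and the [f]-expansion of [h x] is
    the classical expansion of [x].  It remains to choose [h] mapping the set of
    reals with periodic classical expansion onto the set of cubic irrationals.
    Both sets are countable, dense, invariant under integer translations and
    disjoint from the integers, so Cantor's theorem on countable dense orders
    provides such an [h] on [0, 1[; Lagrange's theorem is not needed. *)

(** * Isomorphism of countable dense orders *)

Section OrderIso.
Variable R : realType.
Implicit Types (e : nat -> R) (l r x y : R) (w : seq bool).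

Definition dense_enum e :=
  (forall n, 0 < e n < 1) /\
  forall x y, 0 <= x -> x < y -> y <= 1 -> exists n, x < e n < y.

(** 0 is the value on intervals without a point of [e]; there is none with [0 <= l < r <= 1] when
    [dense_enum e] holds. *)
Definition first_in e l r : R :=
  if pselect (exists n, l < e n < r) is left h then e (ex_minn h) else 0.

(* The binary search tree of [e] on ]l, r[: the root is the first point of [e]
   in the interval, and the path [w] turns right at each [true]. *)
Fixpoint tree_node e l r w : R :=
  if w is b :: w' then
    if b then tree_node e (first_in e l r) r w'
    else tree_node e l (first_in e l r) w'
  else first_in e l r.

Lemma first_inP e l r : (exists n, l < e n < r) ->
  exists n, [/\ first_in e l r = e n, l < e n < r &
                forall k, l < e k < r -> (n <= k)%N].
Proof.
rewrite /first_in; case: pselect => // h _.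
by case: ex_minnP => n hn hmin; exists n.
Qed.

Lemma first_in_itv e l r : dense_enum e -> 0 <= l -> l < r -> r <= 1 ->
  l < first_in e l r < r.
Proof.
move=> [_ ed] l0 lr r1.
by have [n [-> hn _]] := first_inP (ed _ _ l0 lr r1).
Qed.

Lemma tree_node_itv e l r w : dense_enum e -> 0 <= l -> l < r -> r <= 1 ->
  l < tree_node e l r w < r.
Proof.
move=> ed; elim: w l r => [|b w IH] l r l0 lr r1 /=.
  exact: first_in_itv.
have /andP[lm mr] := first_in_itv ed l0 lr r1.
case: b.
  have /andP[h1 h2] := IH _ _ (le_trans l0 (ltW lm)) mr r1.
  by rewrite h2 (lt_trans lm h1).
have /andP[h1 h2] := IH _ _ l0 lm (le_trans (ltW mr) r1).
by rewrite h1 (lt_trans h2 mr).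
Qed.

(** How two nodes compare depends only on their paths: where these part, the left subtree lies below
    the root and the right one above it. So any two dense enumerations order the paths alike, which
    is Cantor's isomorphism. *)
Lemma tree_node_lt e e' l r l' r' w w' : dense_enum e -> dense_enum e' ->
  0 <= l -> l < r -> r <= 1 -> 0 <= l' -> l' < r' -> r' <= 1 ->
  tree_node e l r w < tree_node e l r w' ->
  tree_node e' l' r' w < tree_node e' l' r' w'.
Proof.
move=> ed ed'; elim: w w' l r l' r' => [|b w IH] [|b' w'] l r l' r'
  l0 lr r1 l0' lr' r1' /=; rewrite ?ltxx //.
all: have /andP[lm mr] := first_in_itv ed l0 lr r1.
all: have /andP[lm' mr'] := first_in_itv ed' l0' lr' r1'.
all: have m0 := le_trans l0 (ltW lm); have m1 := le_trans (ltW mr) r1.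
all: have m0' := le_trans l0' (ltW lm'); have m1' := le_trans (ltW mr') r1'.
(* [T] and [U] place the left and right subtrees on either side of the root of the first tree, [T']
   and [U'] those of the second. *)
all: have T := fun w => tree_node_itv w ed l0 lm m1.
all: have U := fun w => tree_node_itv w ed m0 mr r1.
all: have T' := fun w => tree_node_itv w ed' l0' lm' m1'.
all: have U' := fun w => tree_node_itv w ed' m0' mr' r1'.
- case: b' => h; first by have /andP[] := U' w'.
  by have /andP[_ /(lt_trans h)] := T w'; rewrite ltxx.
- case: b => h; last by have /andP[] := T' w.
  by have /andP[/lt_trans/(_ h)] := U w; rewrite ltxx.
case: b; case: b' => h.
- exact: (IH w' _ _ _ _ m0 mr r1 m0' mr' r1').
- have /andP[a _] := U w; have /andP[_ b] := T w'.
  by have := lt_trans (lt_trans a h) b; rewrite ltxx.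
- have /andP[_ a] := T' w; have /andP[b _] := U' w'.
  exact: lt_trans a b.
- exact: (IH w' _ _ _ _ l0 lm m1 l0' lm' m1').
Qed.

Lemma tree_node_enum e l r w : dense_enum e -> 0 <= l -> l < r -> r <= 1 ->
  exists n, tree_node e l r w = e n.
Proof.
move=> ed; elim: w l r => [|b w IH] l r l0 lr r1 /=.
  by have [n [-> _ _]] := first_inP (ed.2 _ _ l0 lr r1); exists n.
have /andP[lm mr] := first_in_itv ed l0 lr r1.
case: b; apply: IH => //; first exact: le_trans l0 (ltW lm).
exact: le_trans (ltW mr) r1.
Qed.

(* After k steps down the tree every index below k has left the current
   interval, so e n is met at depth at most n. *)
Lemma tree_node_onto e n l r k : dense_enum e -> 0 <= l -> r <= 1 ->
  l < e n < r -> (forall i, l < e i < r -> (k <= i)%N) ->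
  exists w, tree_node e l r w = e n.
Proof.
move=> ed; have [d] := ubnP (n.+1 - k).
elim: d l r k => [//|d IH] l r k ltd l0 r1 lnr hk.
have kn : (k <= n)%N := hk _ lnr.
have lr : l < r by case/andP: lnr; exact: lt_trans.
have [j [mE /andP[lm mr] jmin]] := first_inP (ex_intro _ n lnr).
have kj : (k <= j)%N by apply: hk; rewrite lm mr.
case: (ltgtP (e n) (e j)) => [nj|jn|nj].
- have [|||i /andP[li ij]|w wE] := IH l (e j) k.+1 _ l0.
  + by move: ltd kn; clear; lia.
  + exact: le_trans (ltW mr) r1.
  + by case/andP: lnr => -> _; rewrite nj.
  + have ji : (j <= i)%N by apply: jmin; rewrite li (lt_trans ij mr).
    have nij : i <> j by move=> E; rewrite E ltxx in ij.
    by move: kj ji nij; clear; lia.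
  by exists (false :: w); rewrite /= mE.
- have [||||i /andP[ji ir]|w wE] := IH (e j) r k.+1.
  + by move: ltd kn; clear; lia.
  + exact: le_trans l0 (ltW lm).
  + by [].
  + by case/andP: lnr => _ ->; rewrite jn.
  + have ji' : (j <= i)%N by apply: jmin; rewrite ir (lt_trans lm ji).
    have nij : i <> j by move=> E; rewrite E ltxx in ji.
    by move: kj ji' nij; clear; lia.
  by exists (true :: w); rewrite /= mE.
by exists [::]; rewrite /= mE nj.
Qed.

(* Extends to the line the increasing bijection between the ranges of [e] and
   [e'] that identifies nodes with the same path; the point 0 keeps the supremum
   meaningful when no node is below [x]. *)
Definition tree_cut e e' x : R :=
  sup ([set 0] `|` [set tree_node e' 0 1 w | w in
                     [set w | tree_node e 0 1 w <= x]]).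

Section Cut.
Variables e e' : nat -> R.
Hypotheses (ed : dense_enum e) (ed' : dense_enum e').

Let node w := tree_node e 0 1 w.
Let node' w := tree_node e' 0 1 w.

Let node_lt w w' : node w < node w' -> node' w < node' w'.
Proof. by apply: tree_node_lt. Qed.

Let node'_lt w w' : node' w < node' w' -> node w < node w'.
Proof. by apply: tree_node_lt. Qed.

Let node_le w w' : node w <= node w' -> node' w <= node' w'.
Proof. by move=> h; rewrite leNgt; apply/negP => /node'_lt; rewrite ltNge h. Qed.


Let node'01 w : 0 < node' w < 1.
Proof. exact: tree_node_itv. Qed.

Lemma dense_tree_node x y : 0 <= x -> x < y -> y <= 1 ->
  exists w, x < tree_node e 0 1 w < y.
Proof.
move=> x0 xy y1; have [n /andP[xn ny]] := ed.2 _ _ x0 xy y1.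
have [w wE] := @tree_node_onto e n 0 1 0 ed (lexx _) (lexx _) (ed.1 n)
  (fun _ _ => isT).
by exists w; rewrite wE xn.
Qed.

Lemma tree_cut_has_ubound x :
  has_ubound ([set 0] `|` [set tree_node e' 0 1 w | w in
                     [set w | tree_node e 0 1 w <= x]]).
Proof.
by exists 1 => _ [->|[w _ <-]]; rewrite ?ler01// ltW//; case/andP: (node'01 w).
Qed.

Lemma tree_cut_ge0 x : 0 <= tree_cut e e' x.
Proof. by apply: ub_le_sup; [exact: tree_cut_has_ubound|left]. Qed.

Lemma le_tree_cut x w : node w <= x -> node' w <= tree_cut e e' x.
Proof.
by move=> wx; apply: ub_le_sup; [exact: tree_cut_has_ubound|right; exists w].
Qed.

Lemma tree_cut_le x w : x < node w -> tree_cut e e' x <= node' w.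
Proof.
move=> xw; apply: ge_sup; first by exists 0; left.
move=> _ [->|[v vx <-]]; first by rewrite ltW//; case/andP: (node'01 w).
by apply/ltW/node_lt/(le_lt_trans vx).
Qed.

Lemma tree_cut_node w : tree_cut e e' (node w) = node' w.
Proof.
apply/eqP; rewrite eq_le le_tree_cut// andbT.
apply: ge_sup; first by exists 0; left.
move=> _ [->|[v vx <-]]; first by rewrite ltW//; case/andP: (node'01 w).
exact: node_le.
Qed.

(** Two nodes [v], [w] strictly between [x] and [y] are used: the bounds at [x] and [y] are only
    weak, so strictness comes from comparing [v] with [w] in the other tree. *)
Lemma tree_cut_lt x y : 0 <= x -> x < y -> y <= 1 ->
  tree_cut e e' x < tree_cut e e' y.
Proof.
move=> x0 xy y1; have [w /andP[xw wy]] := dense_tree_node x0 xy y1.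
have [v /andP[xv vw]] := dense_tree_node x0 xw (le_trans (ltW wy) y1).
by rewrite (le_lt_trans (tree_cut_le xv))// (lt_le_trans (node_lt vw))//
  le_tree_cut// ltW.
Qed.

Lemma tree_cut_lt1 x : 0 <= x < 1 -> tree_cut e e' x < 1.
Proof.
move=> /andP[x0 x1]; have [w /andP[xw w1]] := dense_tree_node x0 x1 (lexx _).
by apply: le_lt_trans (tree_cut_le xw) _; case/andP: (node'01 w).
Qed.

Lemma tree_cut_enum n : exists m, tree_cut e e' (e n) = e' m.
Proof.
have [w wE] := @tree_node_onto e n 0 1 0 ed (lexx _) (lexx _) (ed.1 n)
  (fun _ _ => isT).
have [m mE] := @tree_node_enum e' 0 1 w ed' (lexx _) ltr01 (lexx _).
by exists m; rewrite -wE tree_cut_node.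
Qed.

End Cut.

Lemma tree_cutK e e' x : dense_enum e -> dense_enum e' -> 0 <= x < 1 ->
  tree_cut e' e (tree_cut e e' x) = x.
Proof.
move=> ed ed' /andP[x0 x1].
have y1 : tree_cut e e' x < 1 by apply: tree_cut_lt1 => //; rewrite x0.
have y0 := tree_cut_ge0 e ed' x.
have z1 : tree_cut e' e (tree_cut e e' x) < 1.
  by apply: tree_cut_lt1 => //; rewrite y0.
have z0 := tree_cut_ge0 e' ed (tree_cut e e' x).
apply/eqP; rewrite eq_le; apply/andP; split; rewrite leNgt; apply/negP => h.
(* [tree_cut_le] yields a weak inequality but takes a strict one; the extra node [v] below [w]
   restores strictness before its second use. *)
- have [w /andP[xw wz]] := dense_tree_node ed x0 h (ltW z1).
  have [v /andP[xv vw]] := dense_tree_node ed x0 xw (ltW (lt_trans wz z1)).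
  have a := tree_cut_le ed ed' xv.
  have b : tree_node e' 0 1 v < tree_node e' 0 1 w
    by apply: (@tree_node_lt e e' 0 1 0 1).
  have := tree_cut_le ed' ed (le_lt_trans a b).
  by rewrite leNgt wz.
- have [w /andP[xw wz]] := dense_tree_node ed z0 h (ltW x1).
  have := le_tree_cut ed (le_tree_cut ed' (ltW wz)).
  by rewrite leNgt xw.
Qed.

End OrderIso.

(** * Floors and fractional parts *)

Section FloorFract.
Variable R : realType.
Implicit Types (x u : R) (n : int).

Lemma fract_itv x : 0 <= fract x < 1.
Proof.
have := floor_itv x; rewrite intrD /fract => /andP[? ?].
by rewrite subr_ge0 ltrBlDl; apply/andP.
Qed.

Lemma floorDfract x : (Num.floor x)%:~R + fract x = x.
Proof. by rewrite /fract addrC subrK. Qed.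

Lemma floorDint x n : Num.floor (x + n%:~R) = Num.floor x + n.
Proof. by rewrite floorDrz ?intrKfloor// intr_int. Qed.

Lemma fractDint x n : fract (x + n%:~R) = fract x.
Proof. by rewrite /fract floorDint intrD; ring. Qed.

Lemma floor_int_add n u : 0 <= u < 1 -> Num.floor (n%:~R + u) = n.
Proof.
by move=> /andP[u0 u1]; apply: floor_def; rewrite intrD lerDl ltrD2l u0 u1.
Qed.

Lemma fract_int_add n u : 0 <= u < 1 -> fract (n%:~R + u) = u.
Proof. by move=> u01; rewrite /fract floor_int_add// addrC addKr. Qed.

Lemma fract_eq0 x : (fract x == 0) = (x \is a Num.int).
Proof. by rewrite intrEfloor subr_eq0 eq_sym. Qed.

End FloorFract.

(** A countable set is empty or the range of a sequence; density rules out the former for the part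
    of [A] in ]0, 1[. *)
Lemma countable_dense_enum (R : realType) (A : set R) : countable A ->
  (forall x y, x < y -> exists2 z, A z & x < z < y) ->
  exists2 e, dense_enum e & forall x, 0 < x < 1 -> (A x <-> exists n, e n = x).
Proof.
move=> cA dA; pose B := A `&` [set x | 0 < x < 1].
have cB : countable B.
  by apply: sub_countable cA; apply: subset_card_le; exact: subIsetl.
have [B0|[e]] := pfcard_geP cB.
  have [z Az z01] := dA 0 1 ltr01.
  by have : B z by []; rewrite B0.
exists e; first split=> [n|x y x0 xy y1].
- by have [] : B (e n) by exact: funS.
- have [z Az /andP[xz zy]] := dA x y xy.
  have Bz : B z by split=> //=; rewrite (le_lt_trans x0 xz) (lt_le_trans zy y1).
  by have [n _ enz] := @surj _ _ _ _ e z Bz; exists n; rewrite enz xz.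
move=> x x01; split=> [Ax|[n <-]].
  by have [n _ enx] := @surj _ _ _ _ e x (conj Ax x01); exists n.
by have [] : B (e n) by exact: funS.
Qed.

(** * Extension from [0, 1[ to the line by integer translations *)

Section Periodic.
Variable R : realType.
Implicit Types (H K : R -> R) (x y : R).

Definition int_extend H x : R := (Num.floor x)%:~R + H (fract x).

Lemma int_extendK H K : (forall x, 0 <= x < 1 -> 0 <= H x < 1) ->
  (forall x, 0 <= x < 1 -> K (H x) = x) ->
  cancel (int_extend H) (int_extend K).
Proof.
move=> H01 HK x; have Hx := H01 _ (fract_itv x).
rewrite /int_extend floor_int_add// fract_int_add// HK ?fract_itv//.
exact: floorDfract.
Qed.

Lemma int_extend_lt H : (forall x, 0 <= x < 1 -> 0 <= H x < 1) ->
  (forall x y, 0 <= x -> x < y -> y <= 1 -> H x < H y) ->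
  {homo int_extend H : x y / x < y}.
Proof.
move=> H01 Hlt x y xy.
have /andP[x0 x1] := fract_itv x; have /andP[y0 y1] := fract_itv y.
have /andP[hx0 hx1] := H01 _ (fract_itv x).
have /andP[hy0 hy1] := H01 _ (fract_itv y).
rewrite /int_extend; move: (le_floor (ltW xy)); rewrite le_eqVlt => /orP[/eqP E|].
  rewrite E ltrD2l Hlt ?(ltW y1)//.
  by rewrite -(ltrD2l (Num.floor x)%:~R) floorDfract E floorDfract.
(* With different floors, the image of [x] is below [floor x + 1], hence below [floor y], which
   bounds the image of [y] from below. *)
rewrite -lezD1 -(ler_int R) intrD => E.
by apply: lt_le_trans (_ : (Num.floor x)%:~R + 1 <= _); lra.
Qed.

Lemma int_extendD H x (n : int) :
  int_extend H (x + n%:~R) = int_extend H x + n%:~R.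
Proof. by rewrite /int_extend floorDint fractDint intrD addrAC. Qed.

(** These are the lifts to the line of the orientation-preserving circle homeomorphisms that fix the
    base point, given together with their inverses. *)
Definition int_order_iso (h k : R -> R) : Prop :=
  [/\ cancel h k, cancel k h, {homo h : x y / x < y}, h 0 = 0 &
      forall x (n : int), h (x + n%:~R) = h x + n%:~R].

Lemma int_order_iso_countable_dense (A B : set R) :
  countable A -> countable B ->
  (forall x y, x < y -> exists2 z, A z & x < z < y) ->
  (forall x y, x < y -> exists2 z, B z & x < z < y) ->
  (forall x (n : int), A (x + n%:~R) <-> A x) ->
  (forall x (n : int), B (x + n%:~R) <-> B x) ->
  ~ A 0 -> ~ B 0 ->
  exists h k : R -> R, int_order_iso h k /\ forall x, A x <-> B (h x).
Proof.
move=> cA cB dA dB tA tB A0 B0.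
have [e ed eA] := countable_dense_enum cA dA.
have [e' ed' eB] := countable_dense_enum cB dB.
pose H := tree_cut e e'; pose K := tree_cut e' e.
have H01 x : 0 <= x < 1 -> 0 <= H x < 1.
  by move=> x01; rewrite tree_cut_ge0// tree_cut_lt1.
have K01 x : 0 <= x < 1 -> 0 <= K x < 1.
  by move=> x01; rewrite tree_cut_ge0// tree_cut_lt1.
have HK x : 0 <= x < 1 -> K (H x) = x by exact: tree_cutK.
have KH x : 0 <= x < 1 -> H (K x) = x by exact: tree_cutK.
have Hlt x y : 0 <= x -> x < y -> y <= 1 -> H x < H y by exact: tree_cut_lt.
have Klt x y : 0 <= x -> x < y -> y <= 1 -> K x < K y by exact: tree_cut_lt.
(* Increasing mutually inverse maps of [0, 1[ fix its least point: [0 < K 0] would give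
   [H 0 < H (K 0) = 0]. *)
have K0 : K 0 = 0.
  have /andP[k0 k1] : 0 <= K 0 < 1 by rewrite K01// lexx ltr01.
  have /andP[h0 h1] : 0 <= H 0 < 1 by rewrite H01// lexx ltr01.
  apply/eqP; rewrite eq_le k0 andbT leNgt; apply/negP.
  move=> /(Hlt _ _ (lexx _))/(_ (ltW k1)).
  by rewrite KH ?lexx ?ltr01// ltNge h0.
have H0 : H 0 = 0 by rewrite -[in LHS]K0 KH// lexx ltr01.
exists (int_extend H), (int_extend K); split.
  split.
  - exact: int_extendK.
  - exact: int_extendK.
  - exact: int_extend_lt.
  - by rewrite /int_extend floor0 /fract floor0 mulr0z subrr H0 addr0.
  - by move=> x n; exact: int_extendD.
(* Invariance under translations reduces the claim to the fractional part; if that is 0, both sides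
   are false. *)
move=> x; rewrite -[x in A x]floorDfract addrC tA /int_extend addrC tB.
have /andP[] := fract_itv x; rewrite le_eqVlt => /orP[/eqP <-|x0] x1.
  by rewrite H0; split.
have hx01 : 0 < H (fract x) < 1.
  by rewrite -[in X in X < _]H0 Hlt ?lexx ?(ltW x1)//= tree_cut_lt1// (ltW x0).
rewrite eA ?x0// eB//; split=> -[n enx].
  by have [m mE] := tree_cut_enum ed ed' n; exists m; rewrite -mE enx.
have [m mE] := tree_cut_enum ed' ed n; exists m.
by rewrite -mE enx [LHS]HK// (ltW x0).
Qed.

End Periodic.

(** * Algebraic numbers of given degree *)

Section Cubic.
Variable R : realType.
Implicit Types (x y : R) (p : {poly rat}).

(** Substituting [X + c] undoes substituting [X - c] and preserves sizes and divisibility, so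
    divisors of the shifted polynomial correspond to divisors of [p]. *)
Lemma irreducible_comp_XsubC (F : fieldType) (p : {poly F}) (c : F) :
  irreducible_poly p -> irreducible_poly (p \Po ('X - c%:P)).
Proof.
move=> [sp ip]; split; first by rewrite size_comp_poly2 ?size_XsubC.
move=> d sd dp; have sX : size ('X + c%:P) = 2 by rewrite size_XaddC.
have dE : (d \Po ('X + c%:P)) \Po ('X - c%:P) = d by exact: comp_polyXaddC_K.
have pE : (p \Po ('X - c%:P)) \Po ('X + c%:P) = p.
  by have := comp_polyXaddC_K p (- c); rewrite polyCN opprK.
have : d \Po ('X + c%:P) %= p.
  apply: ip; first by rewrite size_comp_poly2.
  by rewrite -[X in _ %| X]pE; exact: dvdp_comp_poly.
move=> /andP[h1 h2]; apply/andP; split.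
  by rewrite -[X in X %| _]dE; exact: dvdp_comp_poly.
by rewrite -[X in _ %| X]dE; exact: dvdp_comp_poly.
Qed.

Lemma algebraic_of_degreeDrat d x (q : rat) :
  algebraic_of_degree d x -> algebraic_of_degree d (x + ratr q).
Proof.
move=> [p [pm pi pr ps]]; exists (p \Po ('X - q%:P)); split.
- by rewrite monicE lead_coef_comp ?size_XsubC// (monicP pm) lead_coefXsubC
    expr1n mulr1.
- exact: irreducible_comp_XsubC.
- rewrite map_comp_poly rmorphB /= map_polyX map_polyC /= rootE horner_comp.
  by rewrite !hornerE addrK.
- by rewrite size_comp_poly2 ?size_XsubC.
Qed.

(** A rational root [q] makes [X - q] a divisor of the irreducible [p], hence an associate of it,
    which forces degree 1. *)
Lemma algebraic_of_degree_ratr d (q : rat) : (1 < d)%N ->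
  ~ algebraic_of_degree d (ratr q : R).
Proof.
move=> d1 [p [pm [_ pi] pr ps]].
have /dvdp_size_eqp /= : 'X - q%:P %| p.
  by rewrite dvdp_XsubCl -(fmorph_root (@ratr R)).
rewrite pi ?size_XsubC// ?ps => [/eqP []|]; first by move=> E; rewrite -E in d1.
by rewrite dvdp_XsubCl -(fmorph_root (@ratr R)).
Qed.

Lemma finite_roots (F : fieldType) (p : {poly F}) : p != 0 ->
  finite_set [set x | root p x].
Proof.
have [n] := ubnP (size p); elim: n p => [//|n IH] p ltn p0.
have [[a ra]|nr] := pselect (exists a, root p a); last first.
  suff -> : [set x | root p x] = set0 by exact: finite_set0.
  by apply/seteqP; split=> x //= rx; apply: nr; exists x.
have [q pE] := factor_theorem p a ra.
have q0 : q != 0 by apply: contraNneq p0 => q0; rewrite pE q0 mul0r.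
have sq : (size q < n)%N.
  by move: ltn; rewrite pE size_Mmonic ?monicXsubC// size_XsubC addn2.
apply: sub_finite_set (_ : finite_set ([set x | root q x] `|` [set a])) => /=.
  by move=> x /=; rewrite pE rootM root_XsubC => /orP[rx|/eqP]; [left|right].
by rewrite finite_setU; split; [exact: IH|exact: finite_set1].
Qed.

(** There are countably many nonzero rational polynomials, each with finitely many roots. *)
Lemma countable_algebraic_of_degree d :
  countable [set x : R | algebraic_of_degree d x].
Proof.
pose F p := [set x : R | root (map_poly ratr p) x].
apply: sub_countable (_ : countable (\bigcup_(p in [set p | p != 0]) F p)).
  apply: subset_card_le => x /= [p [pm _ pr _]].
  by exists p => //=; exact: monic_neq0.
apply: bigcup_countable => [|p /= p0]; first exact: countableP.
by apply/finite_set_countable/finite_roots; rewrite map_poly_eq0.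
Qed.

(** Comparing 2-adic valuations of numerator and denominator would give [3 a = 1 + 3 b]. *)
Lemma rat_expn3_neq2 (q : rat) : q ^+ 3 != 2%:R.
Proof.
apply/negP => /eqP E.
have : (`|numq q| ^ 3 = 2 * `|denq q| ^ 3)%N.
  have /(congr1 absz) : numq q ^+ 3 = 2 * denq q ^+ 3.
    apply/eqP; rewrite -(eqr_int rat) rmorphXn/= intrM rmorphXn/=.
    by rewrite numqE exprMn E.
  by rewrite abszM !abszX.
move=> /(congr1 (logn 2)).
rewrite lognM ?expn_gt0 ?absz_gt0 ?denq_neq0// !lognX.
rewrite (logn_prime 2 (isT : prime 2)) eqxx.
by move: (logn 2 `|numq q|) (logn 2 `|denq q|) => a b; clear; lia.
Qed.

(** The witness is the cube root of 2, found by the intermediate value theorem; a cubic without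
    rational roots is irreducible. *)
Lemma exists_cubic : exists x : R, cubic_irrational x.
Proof.
pose p : {poly rat} := 'X^3 - 2%:P.
have sp : size p = 4 by rewrite size_XnsubC.
have [x _ rx] : exists2 x : R, 0 <= x <= 2 & root (map_poly ratr p) x.
  apply: poly_ivt => //.
  rewrite rmorphB /= map_polyXn map_polyC /= !hornerE /= ratr_nat.
  by apply/andP; split; lra.
exists x, p; split => //; first by rewrite monicXnsubC.
apply: cubic_irreducible; first by rewrite sp.
by move=> q; rewrite rootE !hornerE subr_eq0 rat_expn3_neq2.
Qed.

(** The rational translates of the single number [x0] are already dense. *)
Lemma dense_algebraic_of_degree d x0 x y : algebraic_of_degree d x0 -> x < y ->
  exists2 z, algebraic_of_degree d z & x < z < y.
Proof.
move=> cx0 xy; have xy0 : x - x0 < y - x0 by rewrite ltrD2r.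
have [q] := rat_in_itvoo xy0.
rewrite in_itv /= => /andP[h1 h2]; exists (x0 + ratr q).
  exact: algebraic_of_degreeDrat.
by apply/andP; split; lra.
Qed.

End Cubic.

(** * Expansion step by step *)

Section Expansion.
Variable R : realType.
Implicit Types (f : R -> R) (x : R).

Definition econs (a : int) (c : expansion) : expansion :=
  match c with
  | Fin b s => Fin a (b :: s)
  | Inf d => Inf (fun n => if n is m.+1 then d m else a)
  end.

Lemma fexp_int f x : x \is a Num.int -> fexp f x = Fin (Num.floor x) [::].
Proof.
move=> xint; rewrite /fexp; case: pselect => [h|[]]; last by exists 0%N.
by case: ex_minnP => -[|n] _ // /(_ 0%N xint).
Qed.

Lemma fexp_Inf f x : (forall n, fexp_orbit f x n \isn't a Num.int) ->
  fexp f x = Inf (fexp_digit f x).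
Proof.
by move=> nint; rewrite /fexp; case: pselect => // -[n hn]; have := nint n; rewrite hn.
Qed.

Lemma fexp_orbitS f x n :
  fexp_orbit f x n.+1 = fexp_orbit f (phi f (fract x)) n.
Proof. by rewrite /fexp_orbit iterSr. Qed.

Lemma fexp_digitS f x n :
  fexp_digit f x n.+1 = fexp_digit f (phi f (fract x)) n.
Proof. by rewrite /fexp_digit fexp_orbitS. Qed.

Lemma fexp_cons f x : x \isn't a Num.int ->
  fexp f x = econs (Num.floor x) (fexp f (phi f (fract x))).
Proof.
move=> xint; rewrite /fexp; case: pselect => [h|h]; last first.
  case: pselect => [[n hn]|h'] /=; first by case: h; exists n.+1; rewrite fexp_orbitS.
  by congr Inf; apply/funext => -[//|n]; rewrite fexp_digitS.
case: pselect => [h'|[]] /=; last first.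
  case: h => -[|n hn]; first by rewrite /fexp_orbit/= (negbTE xint).
  by exists n; rewrite -fexp_orbitS.
(* As [x] is not an integer, its orbit first meets an integer exactly one step later than the orbit
   of the next iterate. *)
have -> : ex_minn h = (ex_minn h').+1.
  case: ex_minnP => -[|n]; first by rewrite /fexp_orbit/= (negbTE xint).
  rewrite fexp_orbitS => hn nmin; case: ex_minnP => m hm mmin.
  apply/eqP; rewrite eqSS eqn_leq mmin// andbT -ltnS nmin//.
  by rewrite fexp_orbitS.
rewrite /econs /= fexp_digitS; congr (Fin _ (_ :: _)).
rewrite (iotaDl 1 1) -map_comp; apply: eq_map => k /=.
by rewrite add1n fexp_digitS.
Qed.

Lemma econs_C_all a b s : 1 <= b -> (s = [::] -> 2 <= b) -> C_t (Fin b s) ->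
  C_t (Fin a (b :: s)).
Proof.
move=> b1 b2 [/= sall slast]; split=> [|_] /=; first by rewrite b1.
by case: s slast b2 {sall} => [_ ->//|c s ->].
Qed.

Lemma econs_periodic a b c :
  expansion_periodic (econs a c) -> expansion_periodic (econs b c).
Proof.
(* Starting at [N.+1] keeps index 0, the only digit that changes, out of the periodic range. *)
case: c => //= d [N [p [p0 hN]]]; exists N.+1, p; split=> // -[//|n] Nn.
by rewrite -(hN n.+1)// ltnW.
Qed.

Lemma convergentS f a n : convergent f a n.+1 =
  (a 0%N)%:~R + ext1 f (convergent f (fun k => a k.+1) n).
Proof.
rewrite /convergent /= (iotaDl 1 1) -map_comp.
by congr (_ + ext1 f (feval_fin f _ _)); apply: eq_map => k /=; rewrite add1n.
Qed.

End Expansion.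

(** * Classical continued fractions *)

Section ClassicalFractions.
Variable R : realType.
Implicit Types (x y u v : R) (a b : nat -> int) (n : nat).

Local Notation g := (@GRing.inv R).
Local Notation pos_digits a := (forall j : nat, (1 <= j)%N -> 1 <= a j).

Lemma inv_set_bij : set_bij `]1, +oo[%classic `]0, 1[%classic g.
Proof.
split.
- move=> x /=; rewrite !in_itv /= andbT => x1.
  by rewrite invr_gt0 (lt_trans ltr01 x1) invf_lt1// (lt_trans ltr01 x1).
- by move=> x y _ _; exact: invr_inj.
- move=> u /=; rewrite in_itv /= => /andP[u0 u1]; exists u^-1; last exact: invrK.
  by rewrite /= in_itv /= andbT invf_gt1.
Qed.

Lemma phi_inv u : 0 < u < 1 -> phi g u = u^-1.
Proof.
move=> /andP[u0 u1]; rewrite -[u in LHS]invrK; apply: pinvKV.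
  by move=> x y _ _; exact: invr_inj.
by rewrite inE /= in_itv /= andbT invf_gt1.
Qed.

Lemma ext1_inv : ext1 g = g.
Proof. by apply/funext => x; rewrite /ext1; case: eqP => // ->; rewrite invr1. Qed.

Lemma fract_nint_itv x : x \isn't a Num.int -> 0 < fract x < 1.
Proof.
move=> xint; have /andP[x0 ->] := fract_itv x.
by rewrite lt_def x0 fract_eq0 xint.
Qed.

Lemma gauss_gt1 x : x \isn't a Num.int -> 1 < phi g (fract x).
Proof. by move=> /fract_nint_itv fx; rewrite phi_inv// invf_gt1; case/andP: fx. Qed.

Lemma floor_gauss x : x \isn't a Num.int ->
  (Num.floor x)%:~R + (phi g (fract x))^-1 = x.
Proof.
by move=> xint; rewrite phi_inv ?fract_nint_itv// invrK floorDfract.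
Qed.

Lemma fract_add_inv (n : int) y : 1 < y ->
  [/\ Num.floor (n%:~R + y^-1) = n, n%:~R + y^-1 \isn't a Num.int &
      phi g (fract (n%:~R + y^-1)) = y].
Proof.
move=> y1; have y01 : 0 < y^-1 < 1.
  by rewrite invr_gt0 invf_lt1 ?y1 (lt_trans ltr01 y1).
have y01' : 0 <= y^-1 < 1 by case/andP: y01 => /ltW -> ->.
split; first exact: floor_int_add.
  by rewrite -fract_eq0 fract_int_add// gt_eqF//; case/andP: y01.
by rewrite fract_int_add// phi_inv// invrK.
Qed.

Lemma floor_ge2 x : x \is a Num.int -> 1 < x -> 2 <= Num.floor x.
Proof.
by move=> xint x1; rewrite -[2]/(1 + 1) lezD1 -(ltr_int R) floorK.
Qed.

Lemma fexp_inv_Fin x n : fexp_orbit g x n \is a Num.int ->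
  exists s, [/\ fexp g x = Fin (Num.floor x) s, C_t (Fin (Num.floor x) s) &
                feval_fin g (Num.floor x) s = x].
Proof.
elim: n x => [|n IH] x; have [xint|xint] := boolP (x \is a Num.int).
1,3: by move=> _; exists [::]; rewrite fexp_int//=; split=> //; exact: floorK.
  by [].
rewrite fexp_orbitS => /IH[s [sE sC sV]].
exists (Num.floor (phi g (fract x)) :: s); rewrite fexp_cons// sE; split=> //.
  apply: econs_C_all => //; first by rewrite floor_ge_int ltW// gauss_gt1.
  (* If the tail has a single digit, its value is an integer above 1; this is the bound 2 that [C_t]
     demands of a last digit. *)
  move=> s0; rewrite floor_ge2 ?gauss_gt1//.
  by rewrite -sV s0 /= intr_int.
by rewrite /= sV ext1_inv floor_gauss.
Qed.

Lemma feval_inv_ge (a0 : int) s : all (fun a : int => 1 <= a) s ->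
  a0%:~R <= feval_fin g a0 s.
Proof.
elim: s a0 => [|b s IH] a0 /=; first by rewrite lexx.
move=> /andP[b1 /(IH b) h]; rewrite ext1_inv lerDl invr_ge0.
by apply: le_trans h; rewrite ler0z (le_trans ler01 b1).
Qed.

Lemma feval_inv_gt1 (a0 : int) s : 1 <= a0 -> (s = [::] -> 2 <= a0) ->
  all (fun a : int => 1 <= a) s -> 1 < feval_fin g a0 s.
Proof.
case: s => [|b s] a1 a2 /=; first by rewrite ltr1z (lt_le_trans _ (a2 erefl)).
move=> /andP[b1 /(feval_inv_ge b) h]; rewrite ext1_inv.
apply: le_lt_trans (_ : a0%:~R < _); first by rewrite ler1z.
rewrite ltrDl invr_gt0; apply: lt_le_trans h.
by rewrite ltr0z (lt_le_trans ltr01 b1).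
Qed.

Lemma feval_invK (a0 : int) s :
  C_t (Fin a0 s) -> fexp g (feval_fin g a0 s) = Fin a0 s.
Proof.
elim: s a0 => [|b s IH] a0 /= [sall slast].
  by rewrite fexp_int ?intrKfloor ?intr_int.
move: sall => /andP[b1 sall]; have {}slast : 2 <= last b s by exact: slast.
have b2 : s = [::] -> 2 <= b by move=> s0; rewrite s0 in slast.
rewrite ext1_inv; have [f1 f2 f3] := fract_add_inv a0 (feval_inv_gt1 b1 b2 sall).
by rewrite fexp_cons// f1 f3 IH.
Qed.

(* [a 0; a 1, ..., a n + u]. *)
Fixpoint cf_tail a n u : R :=
  if n is n'.+1 then (a 0%N)%:~R + (cf_tail (fun k => a k.+1) n' u)^-1
  else (a 0%N)%:~R + u.

Lemma cf_tail0 a n : cf_tail a n 0 = convergent g a n.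
Proof.
elim: n a => [|n IH] a; first by rewrite /= addr0.
by rewrite convergentS /= ext1_inv IH.
Qed.

Lemma cf_tail_cat a n m u :
  cf_tail a n (cf_tail (fun k => a (n + k)%N) m u - (a n)%:~R) =
  cf_tail a (n + m) u.
Proof.
elim: n a => [|n IH] a; first by rewrite /= addrC subrK.
by rewrite /= -IH.
Qed.

Lemma eq_cf_tail a b n u : (forall k, (k <= n)%N -> a k = b k) ->
  cf_tail a n u = cf_tail b n u.
Proof.
elim: n a b => [|n IH] a b ab /=; rewrite ab//.
by rewrite (IH _ (fun k => b k.+1))// => k kn; rewrite ab.
Qed.

Lemma cf_tail_itv a n u : pos_digits a -> 0 <= u <= 1 ->
  (a 0%N)%:~R <= cf_tail a n u <= (a 0%N)%:~R + 1.
Proof.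
move=> + /andP[u0 u1]; elim: n a => [|n IH] a ap /=.
  by rewrite lerDl lerD2l u0 u1.
have /andP[h _] := IH (fun k => a k.+1) (fun j _ => ap j.+1 isT).
have {}h : 1 <= cf_tail (fun k => a k.+1) n u.
  by apply: le_trans h; rewrite ler1z ap.
by rewrite lerDl lerD2l invr_ge0 invf_le1 ?(lt_le_trans ltr01 h)// h (le_trans ler01 h).
Qed.

(** The map is [x / (c x + 1)], so the difference is [x - y] over [(c x + 1) (c y + 1)], where both
    factors are at least 2. *)
Lemma inv_inv_contract (c x y : R) : 1 <= c -> 1 <= x -> 1 <= y ->
  `|(c + x^-1)^-1 - (c + y^-1)^-1| <= `|x - y| / 4.
Proof.
move=> c1 x1 y1.
have x0 : 0 < x by lra. have y0 : 0 < y by lra.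
have cx : 2 <= c * x + 1 by nra.
have cy : 2 <= c * y + 1 by nra.
have -> : (c + x^-1)^-1 - (c + y^-1)^-1 = (x - y) / ((c * x + 1) * (c * y + 1)).
  by field; rewrite !gt_eqF//; lra.
rewrite normrM ler_wpM2l// ger0_norm ?invr_ge0; last by nra.
by rewrite lef_pV2 ?posrE; nra.
Qed.

(** One inversion need not contract near 1, so the induction removes two digits at a time and gains
    a factor 4. The numerator 2 makes the bound true for [n = 1], where only the unit interval of
    [cf_tail_itv] is at hand. *)
Lemma cf_tail_contract a n u v : pos_digits a -> 0 <= u <= 1 -> 0 <= v <= 1 ->
  `|cf_tail a n u - cf_tail a n v| <= 2 / 2 ^+ n.
Proof.
move=> ap u01 v01; have [k] := ubnP n.
elim: k n a ap => [//|k IH] [|[|n]] a ap nk.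
- rewrite /= expr0 divr1 ler_norml; move/andP: u01 => []; move/andP: v01 => [].
  by move=> *; apply/andP; split; lra.
- have /andP[? ?] := cf_tail_itv 1 ap u01; have /andP[? ?] := cf_tail_itv 1 ap v01.
  by rewrite expr1 divff// ler_norml; apply/andP; split; lra.
have ap1 : pos_digits (fun k => a k.+1) by move=> j _; exact: ap.
have ap2 : pos_digits (fun k => a k.+2) by move=> j _; exact: ap.
have h w : 0 <= w <= 1 -> 1 <= cf_tail (fun k => a k.+2) n w.
  move=> w01; have /andP[+ _] := cf_tail_itv n ap2 w01.
  by apply: le_trans; rewrite ler1z ap.
rewrite /= opprD addrACA subrr add0r.
apply: le_trans (inv_inv_contract _ (h _ u01) (h _ v01)) _; first by rewrite ler1z ap.
have -> : 2 / 2 ^+ n.+2 = 2 / 2 ^+ n / 4 :> R.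
  by rewrite !exprS; field; rewrite expf_neq0.
by rewrite ler_pM2r// IH//; move: nk; clear; lia.
Qed.

Lemma geometric_half_small (e : R) : 0 < e -> exists n, 2 / 2 ^+ n < e :> R.
Proof.
move=> e0; have e2 : 0 < e / 2 by rewrite divr_gt0.
have [n _ /(_ n (leqnn n)) /= h] := near_infty_natSinv_expn_lt (PosNum e2).
by exists n; move: h => /=; rewrite ltr_pdivlMr// div1r mulrC.
Qed.

(** All convergents from the [n]-th on thus lie in the image of [0, 1] under [cf_tail a n], of
    diameter at most [2 / 2 ^+ n]: this makes them a Cauchy sequence. *)
Lemma convergent_cf_tail a n m : pos_digits a ->
  exists2 u, 0 <= u <= 1 & convergent g a (n + m) = cf_tail a n u.
Proof.
move=> ap; exists (cf_tail (fun k => a (n + k)%N) m 0 - (a n)%:~R).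
  have ap' : pos_digits (fun k => a (n + k)%N).
    by move=> j j1; apply: ap; rewrite addn_gt0 j1 orbT.
  have := @cf_tail_itv _ m 0 ap'; rewrite addn0 lexx ler01 => /(_ isT)/andP[h1 h2].
  by rewrite subr_ge0 h1 lerBlDl.
by rewrite cf_tail_cat cf_tail0.
Qed.

Lemma convergent_inv_is_cvg a : pos_digits a -> cvgn (convergent g a).
Proof.
move=> ap; apply/cauchy_cvgP/cauchy_exP => e /geometric_half_small[n ne].
exists (convergent g a n); exists n => // m /= nm.
rewrite /ball /= -(subnKC nm).
have [u u01 ->] := convergent_cf_tail n (m - n) ap.
have [v v01] := convergent_cf_tail n 0 ap; rewrite addn0 => ->.
by apply: le_lt_trans ne; apply: cf_tail_contract.
Qed.

Lemma cf_tail_cvg a x : pos_digits a ->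
  (forall n, exists2 u, 0 <= u <= 1 & x = cf_tail a n u) ->
  convergent g a n @[n --> \oo] --> x.
Proof.
move=> ap xE; apply/cvgrPdist_lt => e /geometric_half_small[n ne].
exists n => // m /= nm; rewrite -(subnKC nm).
have [u u01 ->] := convergent_cf_tail n (m - n) ap.
have [v v01 ->] := xE n.
by apply: le_lt_trans ne; apply: cf_tail_contract.
Qed.

Definition cf_lim a : R := limn (convergent g a).

Lemma cf_lim_ge a : pos_digits a -> (a 0%N)%:~R <= cf_lim a.
Proof.
move=> ap; apply: limr_ge; first exact: convergent_inv_is_cvg.
apply: nearW => n; rewrite -cf_tail0.
by have /andP[] := @cf_tail_itv a n 0 ap (introT andP (conj (lexx _) ler01)).
Qed.

Lemma cf_limS a : pos_digits a ->
  cf_lim a = (a 0%N)%:~R + (cf_lim (fun k => a k.+1))^-1.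
Proof.
move=> ap; have ap1 : pos_digits (fun k => a k.+1) by move=> j _; exact: ap.
have L1 : 1 <= cf_lim (fun k => a k.+1).
  by apply: le_trans (cf_lim_ge ap1); rewrite ler1z ap.
apply: cvg_lim => //; rewrite -cvg_shiftS.
under eq_fun do rewrite convergentS ext1_inv.
apply: cvgD; first exact: cvg_cst.
apply: cvgV; first by rewrite gt_eqF// (lt_le_trans ltr01 L1).
exact: convergent_inv_is_cvg.
Qed.

Lemma cf_lim_gt1 a : pos_digits a -> 1 <= a 0%N -> 1 < cf_lim a.
Proof.
move=> ap a0; have ap1 : pos_digits (fun k => a k.+1) by move=> j _; exact: ap.
have L1 : 1 <= cf_lim (fun k => a k.+1).
  by apply: le_trans (cf_lim_ge ap1); rewrite ler1z ap.
rewrite cf_limS//; apply: le_lt_trans (_ : (a 0%N)%:~R < _); first by rewrite ler1z.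
by rewrite ltrDl invr_gt0 (lt_le_trans ltr01 L1).
Qed.

(** The limit of the shifted sequence is strictly above 1, so its inverse is a genuine fractional
    part and one expansion step strips exactly one digit. *)
Lemma cf_lim_step a : pos_digits a ->
  [/\ Num.floor (cf_lim a) = a 0%N, cf_lim a \isn't a Num.int &
      phi g (fract (cf_lim a)) = cf_lim (fun k => a k.+1)].
Proof.
move=> ap; have ap1 : pos_digits (fun k => a k.+1) by move=> j _; exact: ap.
by rewrite cf_limS//; exact: (fract_add_inv _ (cf_lim_gt1 ap1 (ap 1%N isT))).
Qed.

Lemma fexp_orbit_cf_lim a n : pos_digits a ->
  fexp_orbit g (cf_lim a) n \isn't a Num.int /\ fexp_digit g (cf_lim a) n = a n.
Proof.
elim: n a => [|n IH] a ap; have [fE nint phiE] := cf_lim_step ap; first by [].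
by rewrite fexp_orbitS fexp_digitS phiE; apply: IH => j _; exact: ap.
Qed.

Lemma fexp_cf_lim a : pos_digits a -> fexp g (cf_lim a) = Inf a.
Proof.
move=> ap; rewrite fexp_Inf => [|n]; last by have [] := fexp_orbit_cf_lim n ap.
by congr Inf; apply/funext => n; have [] := fexp_orbit_cf_lim n ap.
Qed.

Section Infinite.
Variable x : R.
Hypothesis xinf : forall n, fexp_orbit g x n \isn't a Num.int.

Lemma fexp_digit_pos : pos_digits (fexp_digit g x).
Proof.
case=> [//|n _]; rewrite /fexp_digit floor_ge_int ltW//.
by rewrite /fexp_orbit iterS; apply: gauss_gt1; exact: xinf.
Qed.

(** With the true remainder in place of 0 the truncated fraction is exact, so [x] lies in the same
    shrinking images of [0, 1] as its convergents. *)
Lemma fexp_digit_cf_tail n :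
  x = cf_tail (fexp_digit g x) n (fract (fexp_orbit g x n)).
Proof.
elim: n x xinf => [|n IH] y yinf; first by rewrite /= floorDfract.
rewrite fexp_orbitS /=.
have /IH : forall m, fexp_orbit g (phi g (fract y)) m \isn't a Num.int.
  by move=> m; rewrite -fexp_orbitS.
under [X in _ = X -> _]eq_cf_tail do rewrite -fexp_digitS.
by move=> <-; rewrite floor_gauss// (yinf 0%N).
Qed.

Lemma convergent_fexp_digit :
  convergent g (fexp_digit g x) n @[n --> \oo] --> x.
Proof.
apply: cf_tail_cvg => [|n]; first exact: fexp_digit_pos.
exists (fract (fexp_orbit g x n)); last exact: fexp_digit_cf_tail.
by have /andP[-> /ltW] := fract_itv (fexp_orbit g x n).
Qed.

End Infinite.

Lemma fexp_inv_cases x :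
  (exists s, [/\ fexp g x = Fin (Num.floor x) s, C_t (Fin (Num.floor x) s) &
                feval_fin g (Num.floor x) s = x]) \/
  (exists a, [/\ fexp g x = Inf a, pos_digits a & cf_lim a = x]).
Proof.
have [[n /fexp_inv_Fin]|h] := pselect (exists n, fexp_orbit g x n \is a Num.int).
  by left.
have xinf n : fexp_orbit g x n \isn't a Num.int.
  by apply/negP => hn; apply: h; exists n.
right; exists (fexp_digit g x); split; first exact: fexp_Inf.
  exact: fexp_digit_pos.
by apply: cvg_lim => //; exact: convergent_fexp_digit.
Qed.

Lemma fexp_invK x : feval g (fexp g x) = x.
Proof. by have [[s [-> _]]|[a [-> _]]] := fexp_inv_cases x. Qed.

Lemma fexp_inv_C_all x : C_all (fexp g x).
Proof. by have [[s [-> h _]]|[a [-> h _]]] := fexp_inv_cases x; [right|left]. Qed.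

Lemma feval_fexp_inv c : C_all c -> fexp g (feval g c) = c.
Proof.
by case: c => [a0 s|a] [] // h; [exact: feval_invK|exact: fexp_cf_lim].
Qed.

Lemma faithful_inv : faithful_fun g.
Proof.
split.
- by case=> [//|a] [] //; exact: convergent_inv_is_cvg.
- split=> [x _|x y _ _ E|c Cc]; first exact: fexp_inv_C_all.
    by rewrite -(fexp_invK x) E fexp_invK.
  by exists (feval g c) => //; exact: feval_fexp_inv.
- exact: fexp_invK.
- exact: feval_fexp_inv.
Qed.

End ClassicalFractions.

(** * Conjugation by an order isomorphism *)

Section Conjugation.
Variable R : realType.
Variables h k : R -> R.
Hypothesis hk : int_order_iso h k.
Implicit Types (f : R -> R) (x y : R).

Let hK : cancel h k. Proof. by case: hk. Qed.
Let kK : cancel k h. Proof. by case: hk. Qed.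
Let h0 : h 0 = 0. Proof. by case: hk. Qed.

Lemma int_order_iso_lt : {mono h : x y / x < y}.
Proof. by apply: leW_mono; apply: le_mono; case: hk. Qed.

Let k_lt : {mono k : x y / x < y}.
Proof. by move=> x y; rewrite -int_order_iso_lt !kK. Qed.

Let hDint (n : int) x : h (n%:~R + x) = n%:~R + h x.
Proof. by case: hk => _ _ _ _ hD; rewrite addrC hD addrC. Qed.

Let h_int (n : int) : h n%:~R = n%:~R.
Proof. by rewrite -[n%:~R]addr0 hDint h0. Qed.

Let h1 : h 1 = 1. Proof. exact: (h_int 1). Qed.

Let h01 x : (0 < h x < 1) = (0 < x < 1).
Proof. by rewrite -[in LHS]h0 -[in LHS]h1 !int_order_iso_lt. Qed.

Let h_gt1 x : (1 < h x) = (1 < x).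
Proof. by rewrite -[in LHS]h1 int_order_iso_lt. Qed.

(** [h] preserves [0, 1[ and commutes with integer translations, hence respects the splitting into
    floor and fractional part. *)
Let fract_h x : fract (h x) = h (fract x) /\ Num.floor (h x) = Num.floor x.
Proof.
have /andP[f0 f1] : 0 <= h (fract x) < 1.
  have /andP[f0 f1] := fract_itv x.
  rewrite -[in X in _ && (_ < X)]h1 int_order_iso_lt f1 andbT.
  by rewrite -[in X in X <= _]h0 leNgt int_order_iso_lt -leNgt.
by rewrite -[x in h x]floorDfract hDint fract_int_add ?floor_int_add ?f0.
Qed.

Let int_h x : (h x \is a Num.int) = (x \is a Num.int).
Proof.
by rewrite -!fract_eq0 (fract_h x).1 -[in X in _ == X]h0 (can_eq hK).
Qed.

Definition conj_fun f x : R := h (f (k x)).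

(** [h] maps the open interval between [k (h x - e)] and [k (h x + e)] into the [e]-ball around
    [h x]. *)
Lemma int_order_iso_continuous : continuous h.
Proof.
move=> x; apply/cvgrPdist_lt => e e0.
have : x \in `]k (h x - e), k (h x + e)[.
  by rewrite in_itv /= -[x in _ < x < _]hK !k_lt; apply/andP; split; lra.
move=> /near_in_itvoo; apply: filterS => y.
rewrite in_itv /= -[y in _ < y < _]hK !k_lt => /andP[? ?].
by rewrite ltr_distlC; apply/andP; split; lra.
Qed.

Lemma conj_fun_bij f : set_bij `]1, +oo[ `]0, 1[ f ->
  set_bij `]1, +oo[ `]0, 1[ (conj_fun f).
Proof.
move=> [fun_f inj_f surj_f]; split.
- move=> x /=; rewrite in_itv/= andbT => x1.
  have := fun_f (k x); rewrite /= !in_itv /= !andbT h01; apply.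
  by rewrite -h_gt1 kK.
- move=> x y; rewrite !inE /= !in_itv /= !andbT => x1 y1 /(can_inj hK).
  move=> /inj_f E; apply: (can_inj kK); apply: E.
    by rewrite inE /= in_itv /= andbT -h_gt1 kK.
  by rewrite inE /= in_itv /= andbT -h_gt1 kK.
- move=> u /=; rewrite in_itv /= -[u in _ < u < _]kK h01 => u01.
  have [|y] := surj_f (k u); first by rewrite /= in_itv.
  rewrite /= in_itv /= andbT => y1 fy.
  by exists (h y); rewrite /= ?in_itv /= ?andbT ?h_gt1// /conj_fun hK fy kK.
Qed.

Lemma phi_conj_fun f u : set_bij `]1, +oo[ `]0, 1[ f -> 0 < u < 1 ->
  phi (conj_fun f) (h u) = h (phi f u).
Proof.
move=> bf u01; have [_ inj_cf _] := conj_fun_bij bf.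
case: bf => _ inj_f surj_f.
have [|y] := surj_f u; first by rewrite /= in_itv.
rewrite /= in_itv /= andbT => y1 <-.
have -> : h (f y) = conj_fun f (h y) by rewrite /conj_fun hK.
rewrite /phi !pinvKV// inE /= in_itv /= andbT//.
by rewrite h_gt1.
Qed.

(** The orbits are compared only up to the first integer: past it the fractional part is 0, outside
    the interval ]0, 1[ on which [phi] inverts [f]. *)
Lemma fexp_orbit_conj_fun f x n : set_bij `]1, +oo[ `]0, 1[ f ->
  (forall m, (m < n)%N -> fexp_orbit f x m \isn't a Num.int) ->
  fexp_orbit (conj_fun f) (h x) n = h (fexp_orbit f x n).
Proof.
move=> bf; elim: n x => [//|n IH] x xint.
rewrite !fexp_orbitS (fract_h x).1 phi_conj_fun//; last first.
  by apply: fract_nint_itv; exact: (xint 0%N).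
by apply: IH => m mn; rewrite -fexp_orbitS; exact: xint.
Qed.

(** [h] intertwines the two iterations and preserves floors and integrality, so both orbits produce
    the same digits and stop together. *)
Lemma fexp_conj_fun f x : set_bij `]1, +oo[ `]0, 1[ f ->
  fexp (conj_fun f) (h x) = fexp f x.
Proof.
move=> bf.
have [[n nint]|xinf] := pselect (exists n, fexp_orbit f x n \is a Num.int).
  elim: n x nint => [|n IH] x nint.
    by rewrite !fexp_int ?int_h// (fract_h x).2.
  have [xint|xint] := boolP (x \is a Num.int).
    by rewrite !fexp_int ?int_h// (fract_h x).2.
  rewrite [LHS]fexp_cons ?int_h// [RHS]fexp_cons// (fract_h x).1 (fract_h x).2.
  rewrite phi_conj_fun ?fract_nint_itv// IH//.
  by rewrite -fexp_orbitS.
have {}xinf n : fexp_orbit f x n \isn't a Num.int.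
  by apply/negP => xn; apply: xinf; exists n.
have orbE n : fexp_orbit (conj_fun f) (h x) n = h (fexp_orbit f x n).
  exact: fexp_orbit_conj_fun.
rewrite !fexp_Inf// => [|n]; last by rewrite orbE int_h.
by congr Inf; apply/funext => n; rewrite /fexp_digit orbE (fract_h _).2.
Qed.

Lemma feval_fin_conj_fun f a0 s :
  feval_fin (conj_fun f) a0 s = h (feval_fin f a0 s).
Proof.
elim: s a0 => [|b s IH] a0 /=; first by rewrite h_int.
rewrite hDint IH /ext1 -[in X in _ == X]h1 (can_eq hK) /conj_fun hK.
by case: ifP; rewrite ?h1.
Qed.

Lemma convergent_conj_fun f a l : convergent f a n @[n --> \oo] --> l ->
  convergent (conj_fun f) a n @[n --> \oo] --> h l.
Proof.
move=> fl; have -> : convergent (conj_fun f) a = h \o convergent f a.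
  by apply/funext => n; exact: feval_fin_conj_fun.
by apply: continuous_cvg => //; exact: int_order_iso_continuous.
Qed.

Lemma feval_conj_fun f c : feval_defined f c ->
  feval_defined (conj_fun f) c /\ feval (conj_fun f) c = h (feval f c).
Proof.
case: c => [a0 s _|a /convergent_conj_fun fa]; first by rewrite /= feval_fin_conj_fun.
by split=> /=; [apply/cvg_ex; exists (h (limn (convergent f a)))|exact: cvg_lim].
Qed.

(** Expansion for the conjugate is expansion for [f] after [k], and evaluation is evaluation for [f]
    followed by [h]. *)
Lemma faithful_conj_fun f : set_bij `]1, +oo[ `]0, 1[ f ->
  faithful_fun f -> faithful_fun (conj_fun f).
Proof.
move=> bf [fdef [fmap finj fsurj] fexpK fevalK].
have E x : fexp (conj_fun f) x = fexp f (k x).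
  by rewrite -[x in LHS]kK fexp_conj_fun.
split.
- by move=> c /fdef /feval_conj_fun[].
- split=> [x _|x y _ _|c /fsurj[x _ <-]].
  + by rewrite E; exact: fmap.
  + rewrite !E => /finj H; apply: (can_inj kK); apply: H; exact: in_setT.
  + by exists (h x); rewrite // fexp_conj_fun.
- move=> x; rewrite E (feval_conj_fun _).2 ?fexpK ?kK//.
  by apply: fdef; exact: fmap.
- move=> c Cc; rewrite E (feval_conj_fun (fdef _ Cc)).2 hK; exact: fevalK.
Qed.

Lemma conj_fun_lt f : {in `]1, +oo[ &, forall x y, x < y -> f y < f x} ->
  {in `]1, +oo[ &, forall x y, x < y -> conj_fun f y < conj_fun f x}.
Proof.
move=> flt x y; rewrite !in_itv /= !andbT => x1 y1 xy.
rewrite int_order_iso_lt flt ?k_lt//.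
  by rewrite in_itv /= andbT -h_gt1 kK.
by rewrite in_itv /= andbT -h_gt1 kK.
Qed.

End Conjugation.

(** * Decreasing bijections belong to the class F *)

Lemma in_classF_bij (R : realType) (f : R -> R) :
  set_bij `]1, +oo[ `]0, 1[ f ->
  {in `]1, +oo[ &, forall x y, x < y -> f y < f x} -> in_classF f.
Proof.
move=> [fun_f inj_f surj_f] flt.
have f01 x : 1 < x -> 0 < f x < 1.
  by move=> x1; have := fun_f x; rewrite /= !in_itv /= andbT; exact.
have fsurj u : 0 < u < 1 -> exists2 x, 1 < x & f x = u.
  move=> u01; have [|x] := surj_f u; first by rewrite /= in_itv.
  by rewrite /= in_itv /= andbT; exists x.
have {}flt x y : 1 < x -> x < y -> f y < f x.
  by move=> x1 xy; apply: flt; rewrite // in_itv /= ?x1 ?(lt_trans x1 xy).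
have flt' x y : 1 < x -> f y < f x -> 1 < y -> x < y.
  move=> x1 fyx y1; rewrite ltNge; apply/negP; rewrite le_eqVlt => /orP[/eqP E|yx].
    by rewrite E ltxx in fyx.
  by have := lt_trans fyx (flt _ _ y1 yx); rewrite ltxx.
split=> //.
- by move=> x y; rewrite !in_itv /= !andbT => x1 _; exact: flt.
- rewrite continuous_open_subspace; last exact: interval_open.
  move=> x; rewrite inE /= in_itv /= andbT => x1.
  have /andP[fx0 fx1] := f01 _ x1.
  apply/cvgrPdist_lt => e e0.
  (* Surjectivity excludes jumps: [y] and [z] are preimages of values within [e] of [f x] on either
     side. The [max] and [min] keep these values inside ]0, 1[. *)
  have [|y y1 yE] := fsurj (Num.max (f x - e) (f x / 2)).
    rewrite lt_max gt_max.
    by apply/andP; split; [apply/orP; right|apply/andP; split]; lra.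
  have [|z z1 zE] := fsurj (Num.min (f x + e) ((f x + 1) / 2)).
    rewrite lt_min gt_min.
    by apply/andP; split; [apply/andP; split|apply/orP; right]; lra.
  have xy : x < y by apply: flt' => //; rewrite yE gt_max; apply/andP; split; lra.
  have zx : z < x by apply: flt' => //; rewrite zE lt_min; apply/andP; split; lra.
  have : x \in `]z, y[ by rewrite in_itv /= zx.
  move=> /near_in_itvoo; apply: filterS => w.
  rewrite in_itv /= => /andP[zw wy].
  have := flt _ _ z1 zw; have := flt _ _ (lt_trans z1 zw) wy.
  rewrite yE zE gt_max lt_min => /andP[? _] /andP[? _].
  by rewrite ltr_distlC; apply/andP; split; lra.
- apply/cvgrPdist_lt => e e0.
  have [|y y1 yE] := fsurj (Num.max (1 - e) (1 / 2)).
    rewrite lt_max gt_max.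
    by apply/andP; split; [apply/orP; right|apply/andP; split]; lra.
  near=> w; have w1 : 1 < w by near: w; exact: nbhs_right_gt.
  have wy : w < y by near: w; exact: nbhs_right_lt.
  have /andP[_ ?] := f01 _ w1.
  have := flt _ _ w1 wy; rewrite yE gt_max => /andP[? _].
  by rewrite ltr_distlC; apply/andP; split; lra.
- apply/cvgrPdist_lt => e e0.
  have [|y y1 yE] := fsurj (Num.min e (1 / 2)).
    rewrite lt_min gt_min.
    by apply/andP; split; [apply/andP; split|apply/orP; right]; lra.
  near=> w; have yw : y < w by near: w; apply: nbhs_pinfty_gt; exact: num_real.
  have /andP[? _] := f01 _ (lt_trans y1 yw).
  have := flt _ _ y1 yw; rewrite yE lt_min => /andP[? _].
  by rewrite ltr_distlC; apply/andP; split; lra.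
Unshelve. all: by end_near.
Qed.

(** * Periodic classical continued fractions *)

Section PeriodicFractions.
Variable R : realType.
Implicit Types (x y z : R).

Local Notation g := (@GRing.inv R).

Definition cf_periodic : set R := [set x | expansion_periodic (fexp g x)].

Lemma cf_periodic_int x : x \is a Num.int -> ~ cf_periodic x.
Proof. by move=> xint; rewrite /cf_periodic /= fexp_int. Qed.

(** An integer translation alters only digit 0. *)
Lemma cf_periodicD x (n : int) : cf_periodic (x + n%:~R) <-> cf_periodic x.
Proof.
suff H y (m : int) : cf_periodic y -> cf_periodic (y + m%:~R).
  by split=> [/(H _ (- n))|]; [rewrite intrN addrK|exact: H].
have [/cf_periodic_int//|yint] := boolP (y \is a Num.int).
have yint' : y + m%:~R \isn't a Num.int by rewrite -fract_eq0 fractDint fract_eq0.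
rewrite /cf_periodic /= (fexp_cons _ yint) (fexp_cons _ yint') fractDint.
exact: econs_periodic.
Qed.

Lemma periodic_nth (a : nat -> int) N p n :
  (forall n, (N <= n)%N -> a (n + p)%N = a n) -> (N <= n)%N ->
  a n = a (N + (n - N) %% p)%N.
Proof.
move=> ap Nn; rewrite -[in LHS](subnKC Nn) {1}(divn_eq (n - N) p).
elim: (_ %/ _)%N => [//|q IH].
rewrite -IH -(ap (N + (q * p + _))%N) ?leq_addr//; congr a.
by move: (_ %% _)%N => r; rewrite mulSn; lia.
Qed.

(** A periodic expansion, and hence its value, is determined by [N], [p] and its first [N + p]
    digits, a countable amount of data. *)
Lemma countable_cf_periodic : countable cf_periodic.
Proof.
pose F (t : nat * nat * seq int) : R := feval g (Inf (fun n =>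
  nth 0 t.2 (if (n < t.1.1)%N then n else (t.1.1 + (n - t.1.1) %% t.1.2)%N))).
apply: sub_countable (_ : countable (F @` setT)).
  apply: subset_card_le => x; rewrite /cf_periodic /= -[in X in _ -> X](fexp_invK x).
  case: (fexp g x) => //= a [N [p [p0 ap]]].
  exists (N, p, [seq a i | i <- iota 0 (N + p)]) => //.
  congr (feval _ (Inf _)); apply/funext => n /=.
  case: ltnP => [nN|Nn].
    by rewrite (nth_map 0%N) ?size_iota ?nth_iota ?ltn_addr.
  have lt : (N + (n - N) %% p < N + p)%N by rewrite ltn_add2l ltn_mod.
  by rewrite (nth_map 0%N) ?size_iota// nth_iota// add0n -periodic_nth.
by apply: sub_countable (card_image_le _ _) _; exact: countableP.
Qed.

(** If the next iterate is a rational [q], then [x] is the rational [floor x + q^-1]; so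
    irrationality persists along the orbit. *)
Lemma fexp_orbit_irrational x n : (forall q, x != ratr q) ->
  fexp_orbit g x n \isn't a Num.int.
Proof.
elim: n x => [|n IH] x xq.
  by apply/negP => /intrP[m /eqP xm]; have := xq m%:~R; rewrite ratr_int xm.
have xint : x \isn't a Num.int.
  by apply/negP => /intrP[m /eqP xm]; have := xq m%:~R; rewrite ratr_int xm.
rewrite fexp_orbitS; apply: IH => q; apply/eqP => E.
have /eqP[] := xq ((Num.floor x)%:~R + q^-1).
by rewrite rmorphD /= ratr_int fmorphV /= -E floor_gauss.
Qed.

(** Take an irrational [z] in the interval, here a cubic one, keep enough of its digits and continue
    with ones. *)
Lemma dense_cf_periodic x y : x < y -> exists2 z, cf_periodic z & x < z < y.
Proof.
move=> xy; have [c cc] := exists_cubic R.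
have [z cz /andP[xz zy]] := dense_algebraic_of_degree cc xy.
have zinf n : fexp_orbit g z n \isn't a Num.int.
  apply: fexp_orbit_irrational => q; apply/eqP => zq.
  by move: cz; rewrite zq; exact: algebraic_of_degree_ratr.
have [|n] := @geometric_half_small R (Num.min (z - x) (y - z)).
  by rewrite lt_min !subr_gt0 xz.
rewrite lt_min => /andP[nx ny].
pose b k := if (k <= n)%N then fexp_digit g z k else 1.
have bp j : (1 <= j)%N -> 1 <= b j.
  by rewrite /b; case: ifP => // _; exact: fexp_digit_pos.
have binf m : fexp_orbit g (cf_lim R b) m \isn't a Num.int.
  by have [] := fexp_orbit_cf_lim R m bp.
have bE : fexp_digit g (cf_lim R b) = b.
  by apply/funext => m; have [] := fexp_orbit_cf_lim R m bp.
exists (cf_lim R b).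
  rewrite /cf_periodic /= fexp_cf_lim//=; exists n.+1, 1%N; split=> // m nm.
  by rewrite /b addn1 !ifN -?ltnNge// ltnW.
have f01 (t : R) : 0 <= fract t <= 1 by have /andP[-> /ltW] := fract_itv t.
(* Both numbers share the digits 0 to [n], so they are values of the same [cf_tail] at two
   remainders; [n] makes their distance smaller than that from [z] to either endpoint. *)
have : `|cf_lim R b - z| <= 2 / 2 ^+ n.
  rewrite [X in `|X - _|](fexp_digit_cf_tail binf n) bE.
  rewrite [X in `|_ - X|](fexp_digit_cf_tail zinf n).
  rewrite (@eq_cf_tail _ (fexp_digit g z) b) => [|i ni]; last by rewrite /b ni.
  exact: cf_tail_contract.
by rewrite ler_distl => /andP[? ?]; apply/andP; split; lra.
Qed.

End PeriodicFractions.

(** * Periodic expansions and cubic irrationals *)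

Theorem theorem3 (R : realType) :
  exists f : R -> R, [/\ in_classF f, faithful_fun f &
    forall x : R, expansion_periodic (fexp f x) <-> cubic_irrational x].
Proof.
have [c cc] := exists_cubic R.
have cubicD (x : R) (n : int) : cubic_irrational (x + n%:~R) <-> cubic_irrational x.
  rewrite -(ratr_int R n); split; last exact: algebraic_of_degreeDrat.
  move=> /(@algebraic_of_degreeDrat R 3 _ (- n%:~R)).
  by rewrite rmorphN /= addrK.
have [||||||||h [k [hk per]]] :=
  @int_order_iso_countable_dense R (@cf_periodic R) (@cubic_irrational R).
- exact: countable_cf_periodic.
- exact: countable_algebraic_of_degree.
- exact: dense_cf_periodic.
- by move=> x y; exact: dense_algebraic_of_degree cc.
- exact: cf_periodicD.
- exact: cubicD.
- by apply: cf_periodic_int; rewrite rpred0.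
- by rewrite -(rmorph0 (@ratr R)); exact: algebraic_of_degree_ratr.
exists (conj_fun h k GRing.inv); split.
- apply: in_classF_bij; first by apply: conj_fun_bij => //; exact: inv_set_bij.
  apply: conj_fun_lt => // x y; rewrite !in_itv /= !andbT => x1 y1 xy.
  by rewrite ltf_pV2 ?posrE ?(lt_trans ltr01).
- by apply: faithful_conj_fun => //; [exact: inv_set_bij|exact: faithful_inv].
(* Writing [x] as [h (k x)], its expansion is the classical one of [k x], which is periodic exactly
   when [h (k x)] is cubic. *)
move=> x; have [hK kK _ _ _] := hk; rewrite -[x]kK -per.
by rewrite fexp_conj_fun//; exact: inv_set_bij.
Qed.
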